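(* Let $\mathbf{e}$ be a transitive relation on a set $E$. The completely join-irreducible elements of the lattice $\mathrm{Reg}(\mathbf{e})$ are exactly the sets $\mathbf{p}_{a,b,U}$ with $(a,b,U)\in\mathcal{F}(\mathbf{e})$. Furthermore, $\mathrm{Reg}(\mathbf{e})$ is spatial, i.e., every element is a (possibly infinite) join of completely join-irreducible elements.
   Context: A transitive relation $\mathbf{e}$ on $E$ is viewed as a set of ordered pairs. Write $x\lhd y$ if $(x,y)\in\mathbf{e}$, $x\unlhd y$ if ($x\lhd y$ or $x=y$), and $[a,b]=\{x: a\unlhd x\unlhd b\}$. A subset $\mathbf{a}\subseteq\mathbf{e}$ is closed if transitive, open if $\mathbf{e}\setminus\mathbf{a}$ is transitive; $\mathrm{cl}$ is transitive closure, $\mathrm{int}(\mathbf{a})$ the largest open subset of $\mathbf{a}$; $\mathbf{a}$ is regular closed if $\mathbf{a}=\mathrm{cl}(\mathrm{int}(\mathbf{a}))$. $\mathrm{Reg}(\mathbf{e})$ is the complete lattice of regular closed subsets under inclusion (joins $\mathrm{cl}(\bigcup)$, meets $\mathrm{cl}(\mathrm{int}(\bigcap))$). $\mathcal{F}(\mathbf{e})$ is the set of triples $(a,b,U)$ with $(a,b)\in\mathbf{e}$, $U\subseteq[a,b]$, and such that $a\neq b$ implies $a\notin U$ and $b\in U$; put $U^{\mathsf c}=[a,b]\setminus U$ and $\mathbf{p}_{a,b,U}=\mathbf{e}\cap\big((\{a\}\cup U^{\mathsf c})\times(\{b\}\cup U)\big)$. An element $p$ is completely join-irreducible if it has a unique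 lower cover $p_*$ and every $x<p$ satisfies $x\le p_*$. *)

(* Defs.v *)
From Stdlib Require Import Relation_Operators.
From HB Require Import structures.
From mathcomp Require Import all_boot all_order.
From mathcomp Require Import boolp classical_sets.

Set Implicit Arguments.
Unset Strict Implicit.
Unset Printing Implicit Defensive.

Local Open Scope classical_set_scope.

Section Relations.
Variable E : Type.
Implicit Types a e : set (E * E).

Definition rel_transitive a := forall x y z, a (x, y) -> a (y, z) -> a (x, z).

Definition rel_cl a : set (E * E) :=
  [set xy | clos_trans E (fun x y => a (x, y)) xy.1 xy.2].

Definition rel_open e a := a `<=` e /\ rel_transitive (e `\` a).

(* A union of open sets is open, so this is the largest open subset of a
   (see rel_int_open). *)
Definition rel_int e a : set (E * E) :=
  \bigcup_(u in [set u | rel_open e u /\ u `<=` a]) u.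

Definition regular_closed e : set (set (E * E)) :=
  [set a | a `<=` e /\ a = rel_cl (rel_int e a)].

Definition rel_le e x y := e (x, y) \/ x = y.

Definition rel_interval e x y := [set z | rel_le e x z /\ rel_le e z y].

Definition triples e : set (E * E * set E) :=
  [set t | let: (a, b, U) := t in
    [/\ e (a, b), U `<=` rel_interval e a b & a <> b -> ~ U a /\ U b]].

Definition p_rel e (t : E * E * set E) : set (E * E) :=
  let: (a, b, U) := t in
  e `&` ((a |` (rel_interval e a b `\` U)) `*` (b |` U)).

End Relations.

(* [set_type] turns the set of regular closed subsets into a subtype of
   [set (E * E)]; its order is the one induced by inclusion. *)
Definition Reg (E : Type) (e : set (E * E)) : Type :=
  set_type (regular_closed e).

Section RegOrder.
Variables (E : Type) (e : set (E * E)).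
HB.instance Definition _ := SubChoice.on (Reg e).
HB.instance Definition _ :=
  [SubChoice_isSubPOrder of Reg e by <: with set_display].
End RegOrder.

Section Posets.
Context {d : Order.disp_t} {T : porderType d}.
Implicit Types p q x : T.
Local Open Scope order_scope.

Definition lower_cover p q := q < p /\ forall x, ~ (q < x /\ x < p).

Definition completely_join_irreducible p :=
  exists ps, unique (lower_cover p) ps /\ forall x, x < p -> x <= ps.

End Posets.

(* [supremums S] is the set of least upper bounds of S (at most one). *)
Definition spatial (d : Order.disp_t) (T : porderType d) :=
  forall x : T, exists2 S : set T,
    S `<=` [set p | completely_join_irreducible p] & supremums S x.

(* [Reg e] is a complete lattice: supremums_RegP and infimums_RegP compute the
   joins and meets of its inclusion order. *)
Section RegLattice.
Variables (E : Type) (e : set (E * E)).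
Implicit Types a b : set (E * E).

Lemma rel_cl_trans a : rel_transitive (rel_cl a).
Proof. by move=> x y z; apply: t_trans. Qed.

Lemma sub_rel_cl a : a `<=` rel_cl a.
Proof. by move=> [x y] axy; apply: t_step. Qed.

Lemma rel_cl_min a b : rel_transitive b -> a `<=` b -> rel_cl a `<=` b.
Proof.
move=> btr ab [x y]; rewrite /rel_cl /= => h.
by elim: h => {x y} [x y /ab//|x y z _ bxy _ byz]; apply: btr bxy byz.
Qed.

Lemma rel_cl_mono a b : a `<=` b -> rel_cl a `<=` rel_cl b.
Proof.
by move=> ab; apply: rel_cl_min => [|x /ab]; [apply: rel_cl_trans|apply: sub_rel_cl].
Qed.

Lemma rel_int_sub a : rel_int e a `<=` a.
Proof. by move=> x [u [_ ua] ux]; apply: ua. Qed.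

Lemma rel_int_max a u : rel_open e u -> u `<=` a -> u `<=` rel_int e a.
Proof. by move=> uo ua x ux; exists u. Qed.

Hypothesis etr : rel_transitive e.

Lemma rel_int_open a : rel_open e (rel_int e a).
Proof.
split=> [x [u [[ue _] _] ux]|x y z]; first exact: ue.
move=> [exy nxy] [eyz nyz]; split; first exact: etr exy eyz.
move=> [u [uo ua] uxz].
have [_ ut] := uo.
have uN w : ~ rel_int e a w -> ~ u w by move=> n uw; apply: n; exists u.
by have [] := ut x y z (conj exy (uN _ nxy)) (conj eyz (uN _ nyz)).
Qed.

Lemma rel_int_mono a b : a `<=` b -> rel_int e a `<=` rel_int e b.
Proof.
move=> ab; apply: rel_int_max; first exact: rel_int_open.
by move=> x /rel_int_sub/ab.
Qed.

Lemma regular_cl_int a : regular_closed e (rel_cl (rel_int e a)).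
Proof.
have [ie _] := rel_int_open a.
have ce : rel_cl (rel_int e a) `<=` e by apply: rel_cl_min.
split=> //; apply/seteqP; split; apply: rel_cl_min; try exact: rel_cl_trans.
  move=> x ix; apply: sub_rel_cl; move: x ix; apply: rel_int_max.
    exact: rel_int_open.
  exact: sub_rel_cl.
exact: rel_int_sub.
Qed.

Lemma regP (r : Reg e) : regular_closed e (val r).
Proof. by have := valP r; rewrite inE. Qed.

Lemma leRegP (r s : Reg e) : (r <= s)%O <-> val r `<=` val s.
Proof. by rewrite -Order.le_val subsetEset. Qed.

Lemma supremums_RegP (S : set (Reg e)) (x : Reg e) :
  supremums S x <-> val x = rel_cl (\bigcup_(r in S) val r).
Proof.
set u := \bigcup_(r in S) val r.
have key : rel_cl u = rel_cl (rel_int e (rel_cl u)).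
  apply/seteqP; split; apply: rel_cl_min; try exact: rel_cl_trans.
    move=> z [r Sr rz]; have [_ rE] := regP r; move: rz; rewrite rE.
    apply: rel_cl_mono; apply: rel_int_mono => w rw; apply: sub_rel_cl.
    by exists r.
  exact: rel_int_sub.
have ureg : rel_cl u \in regular_closed e.
  by rewrite inE key; apply: regular_cl_int.
split=> [[ub lb]|xE].
  apply/seteqP; split.
    have /lb /leRegP : ubound S (Sub (rel_cl u) ureg : Reg e).
      by move=> r Sr; apply/leRegP => z rz; apply: sub_rel_cl; exists r.
    by [].
  apply: rel_cl_min; last by move=> z [r /ub/leRegP rx /rx].
  by have [_ ->] := regP x; apply: rel_cl_trans.
split=> [r Sr|y uby]; apply/leRegP; rewrite xE.
  by move=> z rz; apply: sub_rel_cl; exists r.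
apply: rel_cl_min; last by move=> z [r /uby/leRegP ry /ry].
by have [_ ->] := regP y; apply: rel_cl_trans.
Qed.

(* The [e `&` _] only matters for the empty family, whose meet is e. *)
Lemma infimums_RegP (S : set (Reg e)) (x : Reg e) :
  infimums S x <->
  val x = rel_cl (rel_int e (e `&` \bigcap_(r in S) val r)).
Proof.
set m := e `&` _.
have mr r : S r -> rel_cl (rel_int e m) `<=` val r.
  move=> Sr; apply: rel_cl_min; last by move=> z /rel_int_sub[_]; apply.
  by have [_ ->] := regP r; apply: rel_cl_trans.
have mmax (y : Reg e) : lbound S y -> val y `<=` rel_cl (rel_int e m).
  move=> lby; have [ye yE] := regP y; rewrite {1}yE.
  apply/rel_cl_mono/rel_int_mono => z yz; split; first exact: ye.
  by move=> r /lby/leRegP; apply.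
have mreg : rel_cl (rel_int e m) \in regular_closed e.
  by rewrite inE; apply: regular_cl_int.
split=> [[lb ub]|xE].
  apply/seteqP; split; first exact: mmax.
  have /ub /leRegP : lbound S (Sub (rel_cl (rel_int e m)) mreg : Reg e).
    by move=> r Sr; apply/leRegP; apply: mr.
  by [].
by split=> [r Sr|y lby]; apply/leRegP; rewrite xE; [apply: mr|apply: mmax].
Qed.

End RegLattice.

(* Main.v *)
Require Import Defs.
From mathcomp Require Import all_boot all_order.
From mathcomp Require Import boolp classical_sets.

Set Implicit Arguments.
Unset Strict Implicit.
Unset Printing Implicit Defensive.

Import Order.POrderTheory.

Local Open Scope classical_set_scope.

(** If [u] is open and contains [(a, b)], then for
[U = {y in [a, b] | (a, y) in u}], with [a] removed when [a <> b], the set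
[p_{a,b,U}] contains [(a, b)] and is contained in [u].  Taking [u = int x],
every regular closed [x] is the join of the sets [p_{a,b,U}] below it, so the
completely join-irreducible elements are among the [p_{a,b,U}].

Conversely, [p = p_{a,b,U}] is clopen.  Two of its pairs compose only through a
point [y = a = b], so [p] without [(a, b)] is still transitive, and a regular
closed [x] below [p] contains [(a, b)] only if its interior does.  This interior
then contains some [p_{a,b,V}], and [p_{a,b,V}] contained in [p_{a,b,U}] forces
equality, so [x = p].  Hence the regular closed sets strictly below [p] are
those contained in [p] without [(a, b)], and they have a largest element. *)

Section CompletelyJoinIrreducible.
Context {d : Order.disp_t} {T : porderType d}.
Implicit Types (p x : T) (S J : set T).
Local Open Scope order_scope.

Lemma completely_join_irreducibleP p :
  completely_join_irreducible p <-> exists q, forall x, (x < p) = (x <= q).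
Proof.
split=> [[q [[[qp _] _] below]]|[q ltpE]]; exists q.
  by move=> x; apply/idP/idP => [/below//|xq]; apply: le_lt_trans qp.
have qp : q < p by rewrite ltpE.
split=> [|x]; last by rewrite ltpE.
split; first by split=> // x; rewrite ltpE => -[/lt_geF->].
move=> r [rp no_between]; apply/eqP; rewrite eq_sym.
move: (rp); rewrite ltpE le_eqVlt => /orP[//|rq].
by case: (no_between q).
Qed.

Lemma completely_join_irreducible_mem_supremums S p :
  completely_join_irreducible p -> supremums S p -> S p.
Proof.
move=> /completely_join_irreducibleP[q ltpE] [ubp lubp].
apply: contrapT => nSp.
have /lubp : ubound S q.
  move=> r Sr; rewrite -ltpE lt_neqAle (ubp _ Sr) andbT.
  by apply/eqP => rp; apply: nSp; rewrite -rp.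
by rewrite -ltpE ltxx.
Qed.

Definition join_dense J := forall x, supremums (J `&` [set r | r <= x]) x.

Lemma join_dense_spatial J :
  J `<=` completely_join_irreducible -> join_dense J -> spatial T.
Proof.
move=> Jirr Jdense x; exists (J `&` [set r | r <= x]); last exact: Jdense.
by move=> r [/Jirr].
Qed.

Lemma join_dense_completely_join_irreducible J :
  J `<=` completely_join_irreducible -> join_dense J ->
  completely_join_irreducible = J.
Proof.
move=> Jirr Jdense; apply/seteqP; split=> // p irrp.
by have [] := completely_join_irreducible_mem_supremums irrp (Jdense p).
Qed.

End CompletelyJoinIrreducible.

Section TransitiveRelation.
Variables (E : Type) (e : set (E * E)).
Implicit Types a c u : set (E * E).

Lemma rel_cl_id a : rel_transitive a -> rel_cl a = a.
Proof.
by move=> atr; apply/seteqP; split; [apply: rel_cl_min|apply: sub_rel_cl].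
Qed.

Lemma rel_int_id u : rel_open e u -> rel_int e u = u.
Proof.
by move=> uo; apply/seteqP; split; [apply: rel_int_sub|apply: rel_int_max].
Qed.

Lemma clopen_regular_closed a :
  rel_open e a -> rel_transitive a -> regular_closed e a.
Proof. by move=> ao atr; split; [case: ao|rewrite rel_int_id ?rel_cl_id]. Qed.

Lemma regular_closed_trans a : regular_closed e a -> rel_transitive a.
Proof. by move=> [_ ->]; apply: rel_cl_trans. Qed.

(* Otherwise [rel_int e a] would lie in the closed set [c `\ w], and so would
   its closure [a]. *)
Lemma regular_closed_int_mem a c w : regular_closed e a -> a `<=` c ->
  rel_transitive (c `\ w) -> a w -> rel_int e a w.
Proof.
move=> [_ aE] ac cwtr aw; apply: contrapT => niw.
suff /(_ w aw)[_] : a `<=` c `\ w by apply.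
rewrite {1}aE; apply: rel_cl_min => // z iz.
split; first exact: ac (rel_int_sub iz).
by move=> zw; apply: niw; rewrite -zw.
Qed.

Hypothesis etr : rel_transitive e.

Lemma rel_le_trans x y z : rel_le e x y -> rel_le e y z -> rel_le e x z.
Proof.
move=> [xy|->//] [yz|<-]; last by left.
by left; apply: etr xy yz.
Qed.

Lemma rel_openP u : rel_open e u <-> u `<=` e /\
  forall x y z, e (x, y) -> e (y, z) -> u (x, z) -> u (x, y) \/ u (y, z).
Proof.
split=> -[ue uP]; split=> // x y z.
  move=> exy eyz uxz; apply: contrapT => /not_orP[nxy nyz].
  by have [] := uP x y z (conj exy nxy) (conj eyz nyz).
move=> [exy nxy] [eyz nyz]; split; first exact: etr exy eyz.
by move=> /(uP _ _ _ exy eyz)[].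
Qed.

Definition reg_core a : Reg e :=
  Sub (rel_cl (rel_int e a)) (mem_set (regular_cl_int etr a)).

Lemma val_reg_core a : regular_closed e a -> val (reg_core a) = a.
Proof. by case=> _ {2}->. Qed.

Lemma le_reg_core (r : Reg e) a : rel_transitive a ->
  (r <= reg_core a)%O <-> val r `<=` a.
Proof.
move=> atr; split=> [/leRegP rcore|ra]; last first.
  by apply/leRegP; have [_ ->] := regP r; apply/rel_cl_mono/rel_int_mono.
by apply: subset_trans rcore _; apply: rel_cl_min => //; apply: rel_int_sub.
Qed.

End TransitiveRelation.

Section PRel.
Variables (E : Type) (e : set (E * E)).

Lemma p_rel_sub t : p_rel e t `<=` e.
Proof. by case: t => [[a b] U] x []. Qed.

Lemma p_rel_endpoints a b U : e (a, b) -> p_rel e (a, b, U) (a, b).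
Proof. by move=> ab; do !split=> //=; left. Qed.

Lemma triples_mem_left a b U : triples e (a, b, U) -> U a -> a = b.
Proof. by move=> [_ _ Uab] Ua; apply: contrapT => /Uab[]. Qed.

Lemma triples_mem_right a b U : triples e (a, b, U) -> ~ U b -> a = b.
Proof. by move=> [_ _ Uab] nUb; apply: contrapT => /Uab[]. Qed.

Lemma p_rel_composable_eq a b U x y z : triples e (a, b, U) ->
  p_rel e (a, b, U) (x, y) -> p_rel e (a, b, U) (y, z) -> y = a /\ y = b.
Proof.
move=> T [_ [_ /= yr]] [_ [/= yl _]].
case: yr yl => [->|Uy] [yE|[_ nUy]] //.
- by rewrite (triples_mem_right T nUy).
- by rewrite yE in Uy *; rewrite -(triples_mem_left T Uy).
Qed.

Lemma p_rel_subset_eq a b U V :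
  triples e (a, b, U) -> triples e (a, b, V) ->
  p_rel e (a, b, V) `<=` p_rel e (a, b, U) ->
  p_rel e (a, b, V) = p_rel e (a, b, U).
Proof.
move=> TU TV pVU; apply/seteqP; split=> // -[x y] [exy [/= xl yr]].
have [_ UI _] := TU.
split=> //; split=> /=.
- case: xl => [|[xI nUx]]; first by left.
  have [|xa] := pselect (x = a); first by left.
  right; split=> // Vx.
  have eax : e (a, x) by case: xI => -[//|/esym].
  have /pVU[_ [_ /= [xb|//]]] : p_rel e (a, b, V) (a, x).
    by split=> //; split=> /=; [left|right].
  by apply: xa; rewrite xb in nUx *; rewrite (triples_mem_right TU nUx).
- case: yr => [|Uy]; first by left.
  have [|yb] := pselect (y = b); first by left.
  right; apply: contrapT => nVy; have yI := UI _ Uy.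
  have eyb : e (y, b) by case: yI => _ [].
  have /pVU[_ [/= [ya|[_ //]] _]] : p_rel e (a, b, V) (y, b).
    by split=> //; split=> /=; [right|left].
  by apply: yb; rewrite ya in Uy *; rewrite -(triples_mem_left TU Uy).
Qed.

Hypothesis etr : rel_transitive e.

Lemma p_rel_trans t : rel_transitive (p_rel e t).
Proof.
case: t => [[a b] U] x y z [xy [xl _]] [yz [_ zr]].
by split; first exact: etr xy yz.
Qed.

Lemma p_rel_open t : triples e t -> rel_open e (p_rel e t).
Proof.
case: t => [[a b] U] [ab UI _].
apply/(rel_openP etr); split=> [|x y z exy eyz]; first exact: p_rel_sub.
move=> [_ [/= xl zr]].
have ax : rel_le e a x by case: xl => [->|[[]]//]; right.
have zb : rel_le e z b by case: zr => [->|/UI[]//]; right.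
have yI : rel_interval e a b y.
  by split; [apply: rel_le_trans ax _|apply: rel_le_trans zb] => //; left.
by have [yU|nyU] := pselect (U y); [left|right]; split=> //; split=> //=; right.
Qed.

Lemma p_rel_regular_closed t : triples e t -> regular_closed e (p_rel e t).
Proof.
move=> Tt; apply: clopen_regular_closed; last exact: p_rel_trans.
exact: p_rel_open.
Qed.

Lemma p_rel_setD1_trans a b U : triples e (a, b, U) ->
  rel_transitive (p_rel e (a, b, U) `\ (a, b)).
Proof.
move=> T x y z [pxy nxy] [pyz _]; split; first exact: p_rel_trans pxy pyz.
have [_ yb] := p_rel_composable_eq T pxy pyz.
by move=> [xa _]; apply: nxy; rewrite xa yb.
Qed.

Lemma exists_p_rel_sub_open u a b : rel_open e u -> u (a, b) ->
  exists2 U, triples e (a, b, U) & p_rel e (a, b, U) `<=` u.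
Proof.
move=> /(rel_openP etr)[ue u_split] uab.
exists [set y | [/\ rel_interval e a b y, u (a, y) & a <> b -> y <> a]].
  split=> [|y []//|ab]; first exact: ue.
  split; first by case=> _ _ /(_ ab).
  by split=> // [|_ ba]; [split; [left; apply: ue|right]|apply: ab].
move=> [x y] [exy [/= xl yr]].
have uay : u (a, y) by case: yr => [->|[]].
have [->//|xa] := pselect (x = a).
case: xl => [//|[xI nUx]].
have eax : e (a, x) by case: xI => -[//|/esym].
by have [uax|//] := u_split _ _ _ eax exy uay; case: nUx.
Qed.

Lemma p_rel_sub_regular_closed a b U x : triples e (a, b, U) ->
  regular_closed e x -> x `<=` p_rel e (a, b, U) -> x (a, b) ->
  p_rel e (a, b, U) `<=` x.
Proof.
move=> T xreg xp xab.
have iab := regular_closed_int_mem xreg xp (p_rel_setD1_trans T) xab.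
have [V TV pVi] := exists_p_rel_sub_open (rel_int_open etr x) iab.
have pVx := subset_trans pVi (@rel_int_sub _ e x).
by rewrite -(p_rel_subset_eq T TV (subset_trans pVx xp)).
Qed.

Lemma lt_p_rel (r p : Reg e) a b U : triples e (a, b, U) ->
  val p = p_rel e (a, b, U) ->
  (r < p)%O <-> val r `<=` p_rel e (a, b, U) `\ (a, b).
Proof.
move=> T pE; rewrite lt_leAnge; split=> [/andP[/leRegP rp /negP npr] z rz|rp].
  rewrite pE in rp; split; first exact: rp.
  move=> zab; apply: npr; apply/leRegP; rewrite pE.
  by apply: p_rel_sub_regular_closed => //; [apply: regP|rewrite -zab].
apply/andP; split; first by apply/leRegP; rewrite pE => z /rp[].
have [eab _ _] := T.
apply/negP => /leRegP pr.
have rab : val r (a, b) by apply: pr; rewrite pE; apply: p_rel_endpoints.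
by have [_ /(_ erefl)] := rp _ rab.
Qed.

Lemma p_rel_completely_join_irreducible t (p : Reg e) : triples e t ->
  val p = p_rel e t -> completely_join_irreducible p.
Proof.
case: t => [[a b] U] T pE; apply/completely_join_irreducibleP.
exists (reg_core etr (p_rel e (a, b, U) `\ (a, b))) => r.
have le_core := le_reg_core etr r (p_rel_setD1_trans T).
by apply/idP/idP => [/(lt_p_rel _ T pE)/le_core|/le_core/(lt_p_rel _ T pE)].
Qed.

Lemma p_rel_join_dense :
  join_dense [set r : Reg e | [set p_rel e t | t in triples e] (val r)].
Proof.
move=> x; apply/supremums_RegP => //; have [_ xE] := regP x.
apply/seteqP; split.
  rewrite {1}xE; apply: rel_cl_mono => -[a b] iab.
  have [U T pUi] := exists_p_rel_sub_open (rel_int_open etr (val x)) iab.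
  have pE := val_reg_core etr (p_rel_regular_closed T).
  exists (reg_core etr (p_rel e (a, b, U))).
    split; first by exists (a, b, U).
    by apply/leRegP; rewrite pE => z /pUi/rel_int_sub.
  by rewrite pE; apply: p_rel_endpoints; case: T.
apply: rel_cl_min; first exact: regular_closed_trans (regP x).
by move=> z [r [_ /leRegP rx] /rx].
Qed.

End PRel.

Theorem theorem5p8 (E : Type) (e : set (E * E)) (etr : rel_transitive e) :
  [set val p | p in [set p : Reg e | completely_join_irreducible p]]
    = [set p_rel e t | t in triples e]
  /\ spatial (Reg e).
Proof.
have irr : [set r : Reg e | [set p_rel e t | t in triples e] (val r)]
    `<=` completely_join_irreducible.
  by move=> r [t Tt /esym]; apply: p_rel_completely_join_irreducible Tt.
have dense := p_rel_join_dense etr.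
split; last exact: join_dense_spatial irr dense.
rewrite [[set p | _]](join_dense_completely_join_irreducible irr dense).
apply/seteqP; split=> [_ [r ? <-]//|_ [t Tt <-]].
have pE := val_reg_core etr (p_rel_regular_closed etr Tt).
by exists (reg_core etr (p_rel e t)) => //; exists t.
Qed.
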